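(* Let $p$ be a prime and let $\mathcal{L}_p=\bigcup_{j=1}^{\infty}B(a_j,p^{-n_j})$ be a $p$-adic fractal string, written as the disjoint union of its convex components, indexed so that $p^{-n_1}\ge p^{-n_2}\ge\cdots$. Then, for every $\varepsilon>0$, the volume of the thin inner $\varepsilon$-neighborhood of $\mathcal{L}_p$ is given by $$V_{\mathcal{L}_p}(\varepsilon)=p^{-1}\sum_{j>k}p^{-n_j}=p^{-1}\sum_{j:\,p^{-n_j}<\varepsilon}p^{-n_j}=p^{-1}\Big(\zeta_{\mathcal{L}_p}(1)-\sum_{j=1}^{k}p^{-n_j}\Big),$$ where $k=k(\varepsilon)$ is the largest integer such that $p^{-n_k}\ge\varepsilon$.
   Context: $|\cdot|_p$ is normalized by $|p^k|_p=p^{-k}$, and $\mu_H$ is Haar measure on $\mathbb{Q}_p$ with $\mu_H(\mathbb{Z}_p)=1$. Write $B(a,r)=\{x\in\mathbb{Q}_p:|x-a|_p\le r\}$ and $S(a,r)=\{x\in\mathbb{Q}_p:|x-a|_p=r\}$. A $p$-adic fractal string $\mathcal{L}_p$ is a bounded open subset $\Omega$ of $\mathbb{Q}_p$. Its convex components are the maximal balls contained in $\Omega$, i.e. the classes of the equivalence relation on $\Omega$: $x\sim y$ iff some ball $B\subseteq\Omega$ contains both $x$ and $y$. There are at most countably many of them, they are pairwise disjoint, and each has the form $B(a_j,p^{-n_j})=a_j+p^{n_j}\mathbb{Z}_p$ with $n_j\in\mathbb{Z}$. (If there are only finitely many, all sums over $j$ are understood over the existing indices.) The centers $a_j$ are any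 fixed choice. The metric boundary of $\mathcal{L}_p$ is $\beta\mathcal{L}_p=\bigcup_{j}S(a_j,p^{-n_j})$. The thick inner $\varepsilon$-neighborhood is $\mathcal{N}_\varepsilon=\{x\in\mathcal{L}_p: d_p(x,\beta\mathcal{L}_p)<\varepsilon\}$, where $d_p(x,E)=\inf\{|x-y|_p:y\in E\}$. The thin inner $\varepsilon$-neighborhood is $N_\varepsilon=\mathcal{N}_\varepsilon\setminus\beta\mathcal{L}_p$, and $V_{\mathcal{L}_p}(\varepsilon)=\mu_H(N_\varepsilon)=\mu_H(\mathcal{N}_\varepsilon)-\mu_H(\beta\mathcal{L}_p)$. The geometric zeta function is $\zeta_{\mathcal{L}_p}(s)=\sum_j p^{-n_js}$ wherever the series converges; in particular $\zeta_{\mathcal{L}_p}(1)=\sum_j p^{-n_j}=\mu_H(\mathcal{L}_p)<\infty$. If no index satisfies $p^{-n_k}\ge\varepsilon$, then $k=0$ and the sum $\sum_{j=1}^{k}$ is empty. *)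

(* Defs.v *)
From HB Require Import structures.
From mathcomp Require Import all_boot all_order all_algebra.
From mathcomp Require Import zify ring lra.
From mathcomp Require Import ring_quotient.
From mathcomp Require Import complex.
From mathcomp Require Import all_classical all_reals all_analysis.

Set Implicit Arguments.
Unset Strict Implicit.
Unset Printing Implicit Defensive.

Import Order.TTheory GRing.Theory Num.Theory.
Import numFieldNormedType.Exports.

Local Open Scope classical_set_scope.
Local Open Scope ring_scope.

Section rational_absolute_value.
Context (p : nat) (p_prime : prime p).
Implicit Types x y z : rat.

(* |a / b|_p = p ^ (v_p(b) - v_p(a)). *)
Definition qabs (x : rat) : rat :=
  if x == 0 then 0
  else p%:R ^ ((logn p `|denq x|%N)%:Z - (logn p `|numq x|%N)%:Z).

Let p_gt0 : 0 < p%:R :> rat.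
Proof. by rewrite ltr0n prime_gt0. Qed.

Let p_neq0 : p%:R != 0 :> rat. Proof. by rewrite gt_eqF. Qed.

Lemma qabs0 : qabs 0 = 0. Proof. by rewrite /qabs eqxx. Qed.

Lemma qabs_gt0 x : x != 0 -> 0 < qabs x.
Proof. by move=> /negPf x0; rewrite /qabs x0 exprz_gt0. Qed.

Lemma qabs_ge0 x : 0 <= qabs x.
Proof. by have [->|/qabs_gt0/ltW//] := eqVneq x 0; rewrite qabs0. Qed.

Lemma qabs_eq0 x : (qabs x == 0) = (x == 0).
Proof.
by have [->|/qabs_gt0] := eqVneq x 0; [rewrite qabs0 eqxx|move=> /gt_eqF->].
Qed.

Lemma qabs_frac (a b : int) : a != 0 -> b != 0 ->
  qabs (a%:~R / b%:~R) = p%:R ^ ((logn p `|b|%N)%:Z - (logn p `|a|%N)%:Z).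
Proof.
move=> a0 b0; set x := _ / _.
have x0 : x != 0 by rewrite mulf_neq0 ?invr_eq0 ?intr_eq0.
rewrite /qabs (negPf x0); congr (_ ^ _).
have e : a * denq x = numq x * b.
  apply/eqP; rewrite -(eqr_int rat) !rmorphM /= numqE mulrAC.
  by have -> : x * b%:~R = a%:~R by rewrite divfK// intr_eq0.
have {e} : (`|a| * `|denq x|)%N = (`|numq x| * `|b|)%N by rewrite -!abszM e.
move=> /(congr1 (logn p)); rewrite !lognM ?absz_gt0 ?denq_eq0 ?numq_eq0//.
by lia.
Qed.

Lemma qabs1 : qabs 1 = 1.
Proof. by have := @qabs_frac 1 1 isT isT; rewrite divr1 subrr expr0z. Qed.

Lemma qabsM x y : qabs (x * y) = qabs x * qabs y.
Proof.
have [->|x0] := eqVneq x 0; first by rewrite mul0r qabs0 mul0r.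
have [->|y0] := eqVneq y 0; first by rewrite mulr0 qabs0 mulr0.
have dx := denq_neq0 x; have dy := denq_neq0 y.
have nx : numq x != 0 by rewrite numq_eq0.
have ny : numq y != 0 by rewrite numq_eq0.
rewrite -{1}[x]divq_num_den -{1}[y]divq_num_den mulf_div -!intrM.
rewrite qabs_frac ?mulf_neq0// /qabs (negPf x0) (negPf y0) -expfzDr//.
congr (_ ^ _); rewrite !abszM !lognM ?absz_gt0//. lia.
Qed.

Lemma qabsN x : qabs (- x) = qabs x.
Proof. by rewrite /qabs oppr_eq0 numqN denqN abszN. Qed.

Lemma qabsB x y : qabs (x - y) = qabs (y - x).
Proof. by rewrite -opprB qabsN. Qed.

Lemma qabsV (x : rat) : qabs x^-1 = (qabs x)^-1.
Proof.
have [->|x0] := eqVneq x 0; first by rewrite qabs0 !invr0 qabs0.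
have q0 : qabs x != 0 by rewrite qabs_eq0.
by apply: (mulIf q0); rewrite mulVf// -qabsM mulVf// qabs1.
Qed.

Lemma qabsD x y : qabs (x + y) <= Num.max (qabs x) (qabs y).
Proof.
have [->|x0] := eqVneq x 0; first by rewrite add0r le_max lexx orbT.
have [->|y0] := eqVneq y 0; first by rewrite addr0 le_max lexx.
have [->|s0] := eqVneq (x + y) 0; first by rewrite qabs0 le_max qabs_ge0.
have dx := denq_neq0 x; have dy := denq_neq0 y.
pose a : int := numq x * denq y; pose b : int := numq y * denq x.
pose d : int := denq x * denq y.
have d0 : d != 0 by rewrite mulf_neq0.
have fdx : (denq x)%:~R != 0 :> rat by rewrite intr_eq0.
have fdy : (denq y)%:~R != 0 :> rat by rewrite intr_eq0.
have xE : x = a%:~R / d%:~R.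
  rewrite -{1}[x]divq_num_den /a /d !intrM; field.
  by rewrite fdx fdy.
have yE : y = b%:~R / d%:~R.
  rewrite -{1}[y]divq_num_den /b /d !intrM; field.
  by rewrite fdx fdy.
have a0 : a != 0 by rewrite mulf_neq0// numq_eq0.
have b0 : b != 0 by rewrite mulf_neq0// numq_eq0.
have sE : x + y = (a + b)%:~R / d%:~R by rewrite {1}xE {1}yE rmorphD mulrDl.
have ab0 : a + b != 0.
  by apply: contraNneq s0 => ab; rewrite sE ab mul0r.
rewrite sE xE yE !qabs_frac//.
have p1 : 1 < p%:R :> rat by rewrite ltr1n prime_gt1.
rewrite le_max !(ler_eXz2l p1).
suff : (minn (logn p `|a|) (logn p `|b|) <= logn p `|(a + b)%R|)%N by lia.
rewrite -pfactor_dvdn ?absz_gt0//.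
rewrite -(absz_nat (p ^ _)) -dvdzE rpredD// dvdzE absz_nat pfactor_dvdn ?absz_gt0//.
  by rewrite geq_minl.
by rewrite geq_minr.
Qed.

Lemma qabsDle x y z : qabs x <= z -> qabs y <= z -> qabs (x + y) <= z.
Proof. by move=> xz yz; rewrite (le_trans (qabsD _ _))// ge_max xz yz. Qed.

Lemma qabsDlt x y z : qabs x < z -> qabs y < z -> qabs (x + y) < z.
Proof. by move=> xz yz; rewrite (le_lt_trans (qabsD _ _))// gt_max xz yz. Qed.

Lemma qabs_close x y : qabs (x - y) < qabs y -> qabs x = qabs y.
Proof.
move=> xy; apply/eqP; rewrite eq_le; apply/andP; split.
  by rewrite -[x](subrK y) qabsDle// ltW.
rewrite leNgt; apply/negP => xlt.
have : qabs y < qabs y by rewrite -{1}(subKr x y) qabsDlt// qabsN.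
by rewrite ltxx.
Qed.

End rational_absolute_value.
(* Q_p is the completion of Q for |.|_p: the ring of Cauchy sequences of
   rationals modulo the ideal of null sequences. *)
Section padic_field.
Context (p : nat) (p_prime : prime p).
Implicit Types (u v : nat -> rat).

Definition is_cauchy u := forall e : rat, 0 < e ->
  exists N, forall m n, (N <= m)%N -> (N <= n)%N -> qabs p (u m - u n) < e.

Definition is_null u := forall e : rat, 0 < e ->
  exists N, forall n, (N <= n)%N -> qabs p (u n) < e.

Definition cauchy_pred of prime p : {pred nat -> rat} :=
  fun u => `[< is_cauchy u >].

Lemma cauchy_predP u : reflect (is_cauchy u) (u \in cauchy_pred p_prime).
Proof. exact: asboolP. Qed.

Lemma is_cauchy_cst (c : rat) : is_cauchy (fun=> c).
Proof. by move=> e e0; exists 0 => m n _ _; rewrite subrr qabs0. Qed.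

Lemma is_cauchy_bounded u : is_cauchy u ->
  exists2 M, 0 < M & forall n, qabs p (u n) <= M.
Proof.
move=> /(_ 1 ltr01)[N uN].
pose M := 1 + qabs p (u N) + \sum_(i < N) qabs p (u i).
have s0 : 0 <= \sum_(i < N) qabs p (u i).
  by apply: sumr_ge0 => i _; exact: qabs_ge0.
exists M => [|n]; first by rewrite !ltr_pwDl// qabs_ge0.
have [nN|Nn] := ltnP n N.
  rewrite /M (bigD1 (Ordinal nN))//= addrCA lerDl addr_ge0//.
    by rewrite addr_ge0// qabs_ge0.
  by apply: sumr_ge0 => i _; exact: qabs_ge0.
rewrite -(subrK (u N) (u n)) qabsDle//.
  by rewrite (le_trans (ltW (uN _ _ Nn (leqnn _))))// /M -addrA lerDl addr_ge0// qabs_ge0.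
by rewrite /M -addrA addrCA lerDl addr_ge0.
Qed.

Lemma is_cauchyB u v : is_cauchy u -> is_cauchy v -> is_cauchy (u - v).
Proof.
move=> cu cv e e0; have [M uM] := cu _ e0; have [N vN] := cv _ e0.
exists (maxn M N) => m n; rewrite !geq_max => /andP[Mm Nm] /andP[Mn Nn].
rewrite !fctE (_ : _ - _ = (u m - u n) + (v n - v m)); last by ring.
by rewrite qabsDlt// ?uM ?vN.
Qed.

Lemma is_cauchyM u v : is_cauchy u -> is_cauchy v -> is_cauchy (u * v).
Proof.
move=> cu cv e e0.
have [A A0 uA] := is_cauchy_bounded cu; have [B B0 vB] := is_cauchy_bounded cv.
have [M uM] := cu _ (divr_gt0 e0 B0); have [N vN] := cv _ (divr_gt0 e0 A0).
exists (maxn M N) => m n; rewrite !geq_max => /andP[Mm Nm] /andP[Mn Nn].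
rewrite !fctE (_ : _ - _ = (u m - u n) * v m + u n * (v m - v n)); last by ring.
rewrite qabsDlt// qabsM//.
  by rewrite (le_lt_trans (ler_wpM2l (qabs_ge0 p_prime _) (vB _)))// -ltr_pdivlMr// uM.
rewrite (le_lt_trans (ler_wpM2r (qabs_ge0 p_prime _) (uA _)))//.
by rewrite mulrC -ltr_pdivlMr// vN.
Qed.

Lemma cauchy_pred_closed : subring_closed (cauchy_pred p_prime).
Proof.
split=> [|u v /cauchy_predP cu /cauchy_predP cv|
  u v /cauchy_predP cu /cauchy_predP cv]; apply/cauchy_predP.
- exact: is_cauchy_cst.
- exact: is_cauchyB.
- exact: is_cauchyM.
Qed.

HB.instance Definition _ :=
  GRing.isSubringClosed.Build (nat -> rat) (cauchy_pred p_prime)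
    cauchy_pred_closed.

Record cauchy_seq :=
  CauchySeq { seq_val :> nat -> rat; _ : seq_val \in cauchy_pred p_prime }.

HB.instance Definition _ := [isSub for seq_val].
HB.instance Definition _ := [Choice of cauchy_seq by <:].
HB.instance Definition _ := [SubChoice_isSubComNzRing of cauchy_seq by <:].

Lemma cauchy_seqP (u : cauchy_seq) : is_cauchy u.
Proof. by apply/cauchy_predP; exact: valP. Qed.

Definition null_pred : {pred cauchy_seq} := fun u : cauchy_seq => `[< is_null u >].

Lemma null_predP (u : cauchy_seq) : reflect (is_null u) (u \in null_pred).
Proof. exact: asboolP. Qed.

Lemma null_pred_closed : idealr_closed null_pred.
Proof.
split=> [||a u v /null_predP nu /null_predP nv].
- by apply/null_predP => e e0; exists 0 => n _; rewrite qabs0.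
- by apply/negP => /null_predP/(_ 1 ltr01)[N /(_ _ (leqnn _))]; rewrite qabs1.
apply/null_predP => e e0.
have [A A0 aA] := is_cauchy_bounded (cauchy_seqP a).
have [M uM] := nu _ (divr_gt0 e0 A0); have [N vN] := nv _ e0.
exists (maxn M N) => n; rewrite geq_max => /andP[Mn Nn].
rewrite qabsDlt ?vN// qabsM//.
rewrite (le_lt_trans (ler_wpM2r (qabs_ge0 p_prime _) (aA _)))//.
by rewrite mulrC -ltr_pdivlMr// uM.
Qed.

HB.instance Definition _ :=
  isIdealr.Build cauchy_seq null_pred null_pred_closed.

Definition Qp : Type := {ideal_quot null_pred}.
HB.instance Definition _ := GRing.ComNzRing.on Qp.
HB.instance Definition _ := EqQuotient.on Qp.

End padic_field.

Section padic_absolute_value.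
Context (p : nat) (p_prime : prime p).
Notation Qp := (Qp p_prime).
Notation seq_val := (@seq_val p p_prime).
Implicit Types (u v : cauchy_seq p_prime) (x y z : Qp).

Definition Qp_of u : Qp := (\pi_Qp u)%qT.

Lemma Qp_ofP x : exists u, x = Qp_of u.
Proof. by exists (repr x); rewrite /Qp_of reprK. Qed.

Lemma Qp_ofB u v : Qp_of (u - v) = Qp_of u - Qp_of v.
Proof. by rewrite /Qp_of rmorphB. Qed.

Lemma Qp_ofM u v : Qp_of (u * v) = Qp_of u * Qp_of v.
Proof. by rewrite /Qp_of rmorphM. Qed.

Lemma Qp_of1 : Qp_of 1 = 1.
Proof. by rewrite /Qp_of rmorph1. Qed.

Lemma Qp_ofE u v : Qp_of u = Qp_of v <-> is_null p (u - v).
Proof.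
split=> [/eqP|uv].
  by rewrite /Qp_of -Quotient.idealrBE => /null_predP.
by apply/eqP; rewrite /Qp_of -Quotient.idealrBE; apply/null_predP.
Qed.

Lemma Qp_of_eq0 u : Qp_of u = 0 <-> is_null p u.
Proof. by rewrite -(subrr (Qp_of 0)) -Qp_ofB Qp_ofE subrr subr0. Qed.

Lemma qabs_ncst (u : nat -> rat) : is_cauchy p u -> ~ is_null p u ->
  exists2 v, 0 < v & exists N, forall n, (N <= n)%N -> qabs p (u n) = v.
Proof.
move=> cu /existsNP[e /not_implyP[e0 nu]]; have [N uN] := cu _ e0.
have /existsNP[m /not_implyP[Nm /negP]] :
  ~ forall n, (N <= n)%N -> qabs p (u n) < e by move=> h; apply: nu; exists N.
rewrite -leNgt => em; exists (qabs p (u m)); first exact: lt_le_trans em.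
exists N => n Nn; apply: (qabs_close p_prime); apply: lt_le_trans em.
exact: uN.
Qed.

Lemma Qp_mulVx x : x != 0 -> exists y, y * x = 1.
Proof.
have [u ->{x}] := Qp_ofP x => u0.
have [|c c0 [N uc]] := qabs_ncst (cauchy_seqP u).
  by move=> /Qp_of_eq0 /eqP; exact/negP.
have un0 n : (N <= n)%N -> u n != 0.
  by move=> /uc un; rewrite -(qabs_eq0 p_prime) un gt_eqF.
pose v n := (u n)^-1.
have cv : v \in cauchy_pred p_prime.
  apply/cauchy_predP => e e0.
  have [|M uM] := cauchy_seqP u (e := e * c ^+ 2); first by rewrite mulr_gt0 ?exprn_gt0.
  exists (maxn M N) => m n; rewrite !geq_max => /andP[Mm Nm] /andP[Mn Nn].
  have -> : v m - v n = (u n - u m) * (u m * u n)^-1.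
    by rewrite /v; field; rewrite !un0.
  rewrite !(qabsM p_prime) (qabsV p_prime) (qabsM p_prime) !uc// -expr2.
  by rewrite ltr_pdivrMr ?exprn_gt0// uM.
exists (Qp_of (CauchySeq cv)); rewrite -Qp_ofM -Qp_of1; apply/Qp_ofE => e e0.
exists N => n Nn.
have -> : seq_val (CauchySeq cv * u - 1) n = v n * u n - 1 by [].
by rewrite mulVf ?un0// subrr qabs0.
Qed.

Definition Qp_inv x : Qp :=
  if pselect (exists y, x != 0 /\ y * x = 1) is left h then projT1 (cid h)
  else 0.

Lemma Qp_mulVf x : x != 0 -> Qp_inv x * x = 1.
Proof.
move=> x0; rewrite /Qp_inv; case: pselect => [h|]; first by case: cid => y [].
by have [y yx] := Qp_mulVx x0; case; exists y.
Qed.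

Lemma Qp_inv0 : Qp_inv 0 = 0.
Proof.
rewrite /Qp_inv; case: pselect => [h|//].
by have [y [/eqP]] := h.
Qed.

HB.instance Definition _ :=
  GRing.ComNzRing_isField.Build Qp Qp_mulVf Qp_inv0.

(* The limit of |u_n|_p for any Cauchy sequence u representing x; it does not
   depend on u and lies in {0} U p^Z, hence it is rational. *)
Definition padic_abs x : rat :=
  limn (fun n => qabs p (seq_val (repr x) n) : rat^o).

Lemma cvg_null (u : nat -> rat) : is_null p u ->
  (qabs p (u n) : rat^o) @[n --> \oo] --> (0 : rat^o).
Proof.
move=> nu; apply/cvgrPdist_lt => e e0; have [N uN] := nu e e0.
by exists N => // n /= Nn; rewrite sub0r normrN ger0_norm ?qabs_ge0// uN.
Qed.

Lemma padic_abs_null u : is_null p u -> padic_abs (Qp_of u) = 0.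
Proof.
move=> nu; have : Qp_of (repr (Qp_of u)) = 0.
  by rewrite [LHS]reprK; apply/Qp_of_eq0.
by move=> /Qp_of_eq0/cvg_null/cvg_lim; exact.
Qed.

Lemma padic_abs_ncst u c : 0 < c ->
  (exists N, forall n, (N <= n)%N -> qabs p (u n) = c) ->
  padic_abs (Qp_of u) = c.
Proof.
move=> c0 [N uc]; 
suff /cvg_lim : (qabs p (seq_val (repr (Qp_of u)) n) : rat^o) @[n --> \oo] -->
  (c : rat^o) by exact.
have : Qp_of (repr (Qp_of u)) = Qp_of u by rewrite [LHS]reprK.
move=> /Qp_ofE/(_ c c0)[M uM].
apply/cvgrPdist_lt => e e0; exists (maxn M N) => // n; rewrite /= geq_max => /andP[Mn Nn].
suff -> : qabs p (seq_val (repr (Qp_of u)) n) = c by rewrite subrr normr0.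
by rewrite -(uc _ Nn); apply: qabs_close => //; rewrite uc//; exact: uM.
Qed.

Lemma padic_absE u :
  is_null p u /\ padic_abs (Qp_of u) = 0 \/
  0 < padic_abs (Qp_of u) /\
  exists N, forall n, (N <= n)%N -> qabs p (u n) = padic_abs (Qp_of u).
Proof.
have [nu|nu] := pselect (is_null p u); [left|right].
  by split=> //; exact: padic_abs_null.
have [c c0 uc] := qabs_ncst (cauchy_seqP u) nu.
by rewrite (padic_abs_ncst c0 uc).
Qed.

Lemma padic_abs_ge0 x : 0 <= padic_abs x.
Proof. by have [u ->] := Qp_ofP x; case: (padic_absE u) => [[_ ->]|[/ltW]]. Qed.

Lemma padic_abs_eq0 x : padic_abs x = 0 -> x = 0.
Proof.
have [u ->] := Qp_ofP x; case: (padic_absE u) => [[/Qp_of_eq0]//|[u0 _] e].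
by rewrite e ltxx in u0.
Qed.

Lemma padic_abs0 : padic_abs 0 = 0.
Proof.
by have [u e] := Qp_ofP 0; rewrite e padic_abs_null//; apply/Qp_of_eq0.
Qed.

Lemma padic_abs_le_near u c : 0 < c ->
  (exists N, forall n, (N <= n)%N -> qabs p (u n) <= c) ->
  padic_abs (Qp_of u) <= c.
Proof.
move=> c0 [N uN]; case: (padic_absE u) => [[_ ->]|[_ [M uM]]]; first exact: ltW.
by rewrite -(uM (maxn M N)) ?leq_maxl// uN// leq_maxr.
Qed.

Lemma padic_abs_near_le u c : 0 < c -> padic_abs (Qp_of u) <= c ->
  exists N, forall n, (N <= n)%N -> qabs p (u n) <= c.
Proof.
move=> c0; case: (padic_absE u) => [[nu _]|[_ [M uM]] uc] .
  by move=> _; have [N uN] := nu _ c0; exists N => n /uN/ltW.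
by exists M => n /uM->.
Qed.

Lemma padic_absN x : padic_abs (- x) = padic_abs x.
Proof.
have [u ->] := Qp_ofP x; rewrite -[- _]sub0r -(_ : Qp_of 0 = 0);
  last exact/Qp_of_eq0/null_predP/rpred0.
rewrite -Qp_ofB sub0r.
have uN n : qabs p ((- u) n) = qabs p (u n).
  by rewrite (_ : (- u) n = - u n)// qabsN.
case: (padic_absE u) => [[nu ->]|[u0 [N uE]]].
  by apply: padic_abs_null => e /nu[N uNe]; exists N => n; rewrite uN; exact: uNe.
by apply: padic_abs_ncst => //; exists N => n; rewrite uN; exact: uE.
Qed.

Lemma padic_absD x y : padic_abs (x + y) <= Num.max (padic_abs x) (padic_abs y).
Proof.
have [u ->] := Qp_ofP x; have [v ->] := Qp_ofP y.
set c := Num.max _ _.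
have uc : padic_abs (Qp_of u) <= c by rewrite le_max lexx.
have vc : padic_abs (Qp_of v) <= c by rewrite le_max lexx orbT.
have c_ge0 : 0 <= c by rewrite le_max padic_abs_ge0.
move: c_ge0 uc vc; rewrite le_eqVlt => /predU1P[<- u0 v0|c0 uc vc].
  have /padic_abs_eq0 -> : padic_abs (Qp_of u) = 0.
    by apply/eqP; rewrite eq_le u0 padic_abs_ge0.
  have /padic_abs_eq0 -> : padic_abs (Qp_of v) = 0.
    by apply/eqP; rewrite eq_le v0 padic_abs_ge0.
  by rewrite addr0 padic_abs0.
have -> : Qp_of u + Qp_of v = Qp_of (u + v) by rewrite /Qp_of rmorphD.
have [M uM] := padic_abs_near_le c0 uc; have [N vN] := padic_abs_near_le c0 vc.
apply: padic_abs_le_near => //; exists (maxn M N) => n.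
rewrite geq_max => /andP[Mn Nn].
by rewrite (_ : (u + v) n = u n + v n)// qabsDle// ?uM ?vN.
Qed.

Let dist x y := padic_abs (x - y).

Let distxx x : dist x x = 0.
Proof. by rewrite /dist subrr padic_abs0. Qed.

Let dist_eq0 x y : dist x y = 0 -> x = y.
Proof. by move=> /padic_abs_eq0/eqP; rewrite subr_eq0 => /eqP. Qed.

Let distC x y : dist x y = dist y x.
Proof. by rewrite /dist -opprB padic_absN. Qed.

Let dist_triangle y x z : dist x z <= dist x y + dist y z.
Proof.
rewrite /dist -(subrKA y) (le_trans (padic_absD _ _))// ge_max.
by rewrite lerDl lerDr !padic_abs_ge0.
Qed.

HB.instance Definition _ := isPointed.Build Qp 0.
HB.instance Definition _ :=
  isMetric.Build rat Qp distxx dist_eq0 distC dist_triangle.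

Lemma Qp_openP (A : set Qp) : open A <->
  forall x, A x -> exists2 e : rat, 0 < e & forall y, padic_abs (x - y) < e -> A y.
Proof.
have nb x : nbhs (x : Qp) A <->
    exists2 e : rat, 0 < e & forall y, padic_abs (x - y) < e -> A y.
  exact: (@nbhs_ballP rat Qp x A).
by rewrite openE; split => h x Ax; exact/nb/h.
Qed.

End padic_absolute_value.

(* The metric of Q_p takes values in rat, so that its topology does not depend
   on a model R of the real numbers; the R-valued absolute value is its image
   by ratr. *)
Section fractal_strings.
Context (R : realType) (p : nat) (p_prime : prime p).
Notation Qp := (Qp p_prime).
Implicit Types (x y : Qp) (r eps : R) (A E Omega : set Qp).

Definition padic_norm x : R := ratr (padic_abs x).

Definition padic_ball (a : Qp) r : set Qp := [set x | padic_norm (x - a) <= r].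

Definition padic_sphere (a : Qp) r : set Qp := [set x | padic_norm (x - a) = r].

(* d_p(x, E), equal to +oo when E is empty. *)
Definition padic_dist x E : \bar R :=
  ereal_inf [set (padic_norm (x - y))%:E | y in E].

Definition Qp_borel := g_sigma_algebraType (@open Qp).

(* A translation-invariant Borel measure giving the compact open subgroup Z_p
   mass 1 is automatically a Radon measure, hence it is the normalized Haar
   measure. *)
Definition is_haar (mu : {measure set Qp_borel -> \bar R}) : Prop :=
  (forall (a : Qp) (A : set Qp_borel),
     measurable A -> mu [set (a + x : Qp) | x in A] = mu A) /\
  mu (padic_ball 0 1) = 1%E.

Definition fractal_string Omega : Prop :=
  open Omega /\ exists r, Omega `<=` padic_ball 0 r.

Definition convex_equiv Omega x y : Prop :=
  exists (a : Qp) r, [/\ 0 < r, padic_ball a r `<=` Omega,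
                  padic_ball a r x & padic_ball a r y].

Definition convex_components Omega : set (set Qp) :=
  [set [set y | Omega y /\ convex_equiv Omega x y] | x in Omega].

(* J is the set of existing indices, either {1, 2, ...} or {1, ..., N}. *)
Record component_enumeration Omega (J : set nat) (a : nat -> Qp)
    (n : nat -> int) : Prop := {
  enumeration_index : forall j, J j -> (0 < j)%N;
  enumeration_initial : forall i j, J j -> (0 < i <= j)%N -> J i;
  enumeration_bij :
    set_bij J (convex_components Omega)
      (fun j => padic_ball (a j) (p%:R ^ (- n j)));
  enumeration_nonincreasing : forall i j, J i -> J j -> (i <= j)%N ->
    (p%:R ^ (- n j) <= p%:R ^ (- n i) :> R)
}.

Definition metric_boundary (J : set nat) (a : nat -> Qp) (n : nat -> int) :
    set Qp :=
  \bigcup_(j in J) padic_sphere (a j) (p%:R ^ (- n j)).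

Definition thick_inner_nbhd Omega J a n eps : set Qp :=
  [set x | Omega x /\ (padic_dist x (metric_boundary J a n) < eps%:E)%E].

Definition thin_inner_nbhd Omega J a n eps : set Qp :=
  thick_inner_nbhd Omega J a n eps `\` metric_boundary J a n.

Definition thin_inner_volume (mu : {measure set Qp_borel -> \bar R})
    Omega J a n eps : \bar R :=
  mu (thin_inner_nbhd Omega J a n eps).

End fractal_strings.

Section geometric_zeta.
Context (R : realType) (p : nat).
Implicit Types (J : set nat) (n : nat -> int) (s : R[i]).

(* t ^ s = exp (s ln t), for t > 0. *)
Definition cpow (t : R) s : R[i] :=
  (expR (complex.Re s * ln t))%:C%C *
  (cos (complex.Im s * ln t) +i* sin (complex.Im s * ln t))%C.

Definition geometric_zeta_partial J n s (m : nat) : R[i]^o :=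
  \sum_(1 <= j < m.+1 | j \in J) cpow (p%:R ^ (- n j)) s.

(* Only meaningful where the partial sums converge. *)
Definition geometric_zeta J n s : R[i] :=
  limn (geometric_zeta_partial J n s).

(* The largest index k such that p^(-n_k) >= eps, and 0 if there is none. *)
Definition last_large_index J n (eps : R) (k : nat) : Prop :=
  (k = 0%N /\ forall j, J j -> p%:R ^ (- n j) < eps) \/
  [/\ J k, eps <= p%:R ^ (- n k) &
      forall j, J j -> eps <= p%:R ^ (- n j) -> (j <= k)%N].

End geometric_zeta.

(* Main.v *)
Require Import Defs.
From mathcomp Require Import all_boot all_order all_algebra.
From mathcomp Require Import complex.
From mathcomp Require Import zify ring.
From mathcomp Require Import all_classical all_reals all_analysis.

(* In the component B_j = B(a_j, p^-n_j), the open ball B_j \ S_j is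
   B(a_j, p^-(n_j + 1)), of mass p^-(n_j + 1), and all of its points are at
   distance exactly p^-n_j from the metric boundary. Hence the thin inner
   neighborhood is the disjoint union of the balls B_j \ S_j over the j with
   p^-n_j < eps. The masses of balls follow from Haar invariance, as
   B(0, p^-n) splits into p translates of B(0, p^-(n+1)) according to the
   leading digit. *)

Set Implicit Arguments.
Unset Strict Implicit.
Unset Printing Implicit Defensive.

Import Order.TTheory GRing.Theory Num.Theory.
Import numFieldNormedType.Exports.

Local Open Scope classical_set_scope.
Local Open Scope ring_scope.

(** * Multiplicativity, values and leading digits of the rational-valued absolute value *)

Section PadicAbs.
Variables (p : nat) (p_prime : prime p).
Notation Qp := (Qp p_prime).
Implicit Types (x y : Qp).

Let p_gt1 : 1 < p%:R :> rat. Proof. by rewrite ltr1n prime_gt1. Qed.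

Lemma qabs_int_unit (b : int) : ~~ (p %| `|b|)%N -> qabs p b%:~R = 1.
Proof.
move=> pb; have b0 : b != 0 by apply: contraNneq pb => ->.
have := qabs_frac p_prime b0 (oner_neq0 _); rewrite divr1 => ->.
by rewrite (lognE p `|b|) (negPf pb) !andbF logn1 subrr expr0z.
Qed.

Lemma qabs_int_lt1 (b : int) : (p %| `|b|)%N -> qabs p b%:~R < 1.
Proof.
move=> pb; have [->|b0] := eqVneq b 0; first by rewrite qabs0.
have := qabs_frac p_prime b0 (oner_neq0 _); rewrite divr1 => ->.
rewrite logn1 sub0r -[ltRHS](expr0z p%:R) ltr_eXz2l //.
by rewrite oppr_lt0 ltz_nat lognE p_prime /= pb absz_gt0 b0.
Qed.

(** In lowest terms [q = a / b], the bound [|q| <= 1] means that [p] does not divide [b]. So [b] is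
    invertible modulo [p], and the digit is the residue of [a * b^-1]. *)
Lemma qabs_digit (q : rat) : qabs p q <= 1 ->
  exists2 i : nat, (i < p)%N & qabs p (q - i%:R) < 1.
Proof.
have [->|q0] := eqVneq q 0.
  by exists 0; rewrite ?prime_gt0// subrr qabs0.
set a := numq q; set b := denq q.
have b0 : b != 0 by exact: denq_neq0.
move=> q1.
have lba : (logn p `|b|)%:Z - (logn p `|a|)%:Z <= 0.
  by move: q1; rewrite /qabs (negPf q0) -[leRHS](expr0z p%:R) ler_eXz2l.
have cop : coprime `|a| `|b| by exact: coprime_num_den.
(* If [p] divided [b], then [v_p(a) >= v_p(b) > 0], so [p] would divide both terms of a reduced
   fraction. *)
have pb : ~~ (p %| `|b|)%N.
  apply/negP => pb; have /negP : ~~ (p %| `|a|)%N.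
    apply/negP => pa; have : (p %| gcdn `|a| `|b|)%N by rewrite dvdn_gcd pa.
    by rewrite (eqP cop) dvdn1; move: (prime_gt1 p_prime); case: (p) => [|[|]].
  apply; move: lba; rewrite subr_le0 lez_nat.
  rewrite {1}lognE p_prime absz_gt0 b0 pb /= => h.
  have : (0 < logn p `|a|)%N by rewrite (leq_trans _ h).
  by rewrite logn_gt0 mem_primes => /and3P[].
have : coprimez p b by rewrite /coprimez /gcdz eqz_nat -/(coprime _ _) prime_coprime.
(* By Bezout, [u * p + v * b = 1], so [v] inverts [b] modulo [p]; hence the residue of [a * v]
   below. *)
case/coprimezP => -[u v] /= uv.
have p0 : (p : int) != 0 by rewrite eqz_nat -lt0n prime_gt0.
pose m := ((a * v) %% p)%Z.
have m0 : 0 <= m by exact: modz_ge0.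
have mp : m < p by apply: ltz_pmod; rewrite ltz_nat prime_gt0.
have := divz_eq (a * v) p; rewrite -/m; move: m (a * v %/ p)%Z m0 mp => m d m0 mp h.
exists `|m|%N; first by rewrite -ltz_nat gez0_abs.
have -> : (`|m|%N)%:R = m%:~R :> rat by rewrite -[in RHS](gez0_abs m0).
have bQ : b%:~R != 0 :> rat by rewrite intr_eq0.
have -> : q - m%:~R = (a - m * b)%:~R / b%:~R.
  rewrite intrB mulrBl intrM mulfK//; congr (_ - _).
  by rewrite divq_num_den.
rewrite qabsM // qabsV // (qabs_int_unit pb) // invr1 mulr1.
apply: qabs_int_lt1; rewrite -[p]absz_nat -dvdzE.
have -> : a - m * b = (a * u + d * b) * p.
  rewrite -{1}[a]mulr1 -uv mulrDr mulrDl [X in _ + X - _]mulrA h; ring.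
by rewrite dvdz_mull.
Qed.

(** Along a non-null Cauchy sequence [qabs] is eventually constant, so multiplicativity passes from
    a single late term to the limit. *)
Lemma padic_absM x y : padic_abs (x * y) = padic_abs x * padic_abs y.
Proof.
have [u ->] := Qp_ofP x; have [v ->] := Qp_ofP y.
case: (padic_absE u) => [[/Qp_of_eq0 -> _]|[u0 [M uM]]].
  by rewrite !(mul0r, padic_abs0).
case: (padic_absE v) => [[/Qp_of_eq0 -> _]|[v0 [N vN]]].
  by rewrite !(mulr0, padic_abs0).
rewrite -Qp_ofM; apply: padic_abs_ncst; first exact: mulr_gt0.
exists (maxn M N) => n; rewrite geq_max => /andP[Mn Nn].
by rewrite -(uM _ Mn) -(vN _ Nn) -qabsM.
Qed.

Lemma nat_Qp_of (i : nat) : i%:R = Qp_of (i%:R : cauchy_seq p_prime) :> Qp.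
Proof. by rewrite /Qp_of rmorph_nat. Qed.

Lemma cauchy_seq_natE (i m : nat) : (i%:R : cauchy_seq p_prime) m = i%:R.
Proof.
have -> : seq_val (i%:R : cauchy_seq p_prime) = i%:R.
  exact: (rmorph_nat (val : cauchy_seq p_prime -> (nat -> rat))).
by elim: i => [//|i IH]; rewrite !mulrS [LHS]/= -IH.
Qed.

Lemma padic_abs_nat (i : nat) : padic_abs (i%:R : Qp) = qabs p i%:R.
Proof.
have [i0|i0] := eqVneq (i%:R : rat) 0.
  by move/eqP: i0; rewrite pnatr_eq0 => /eqP ->; rewrite padic_abs0 qabs0.
rewrite nat_Qp_of; apply: padic_abs_ncst; first exact: qabs_gt0.
by exists 0 => n _; rewrite cauchy_seq_natE.
Qed.

Lemma padic_abs_digit x : padic_abs x <= 1 ->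
  exists2 i : nat, (i < p)%N & padic_abs (x - i%:R) < 1.
Proof.
have [u ->] := Qp_ofP x => /(padic_abs_near_le ltr01)[M uM].
have [N uN] := cauchy_seqP u ltr01.
(* Past [m] the terms have absolute value at most 1 and differ from [u m] by less than 1, so the
   digit of the rational [u m] is also a digit of the limit. *)
pose m := maxn M N.
have [i ip iu] := qabs_digit (uM m (leq_maxl _ _)).
exists i => //; rewrite nat_Qp_of -Qp_ofB.
case: (padic_absE (u - i%:R)) => [[_ ->]//|[_ [N' uN']]].
rewrite -(uN' (maxn N' m)) ?leq_maxl //.
rewrite (_ : (u - i%:R) _ = (u (maxn N' m) - u m) + (u m - i%:R)); last first.
  by rewrite subrKA -[in RHS](cauchy_seq_natE i (maxn N' m)).
apply: qabsDlt => //; apply: uN; last exact: leq_maxr.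
by rewrite (leq_trans (leq_maxr M N))// leq_maxr.
Qed.

Lemma padic_abs_p : padic_abs (p%:R : Qp) = p%:R^-1.
Proof.
have p0 : (p : int) != 0 by rewrite eqz_nat -lt0n prime_gt0.
rewrite padic_abs_nat; have := qabs_frac p_prime p0 (oner_neq0 _).
by rewrite divr1 => ->; rewrite logn1 /= (pfactorK 1)// sub0r exprN1.
Qed.

Lemma padic_abs_value x : x != 0 -> exists k : int, padic_abs x = p%:R ^ k.
Proof.
have [u ->] := Qp_ofP x => u0.
case: (padic_absE u) => [[/Qp_of_eq0 h]|[c0 [M uM]]]; first by rewrite h eqxx in u0.
move: c0; rewrite -(uM M (leqnn _)) /qabs.
by case: ifP => [_|_ _]; [rewrite ltxx|eexists].
Qed.

End PadicAbs.

(** * The real-valued norm and the ultrametric geometry of balls *)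

Section PadicNorm.
Variables (R : realType) (p : nat) (p_prime : prime p).
Notation Qp := (Qp p_prime).
Notation norm := (@padic_norm R p p_prime).
Implicit Types (x y a b : Qp) (r : R).

Lemma prime_gt0R : 0 < p%:R :> R. Proof. by rewrite ltr0n prime_gt0. Qed.
Lemma prime_gt1R : 1 < p%:R :> R. Proof. by rewrite ltr1n prime_gt1. Qed.
Lemma prime_neq0R : p%:R != 0 :> R. Proof. by rewrite gt_eqF ?prime_gt0R. Qed.
Hint Resolve prime_gt0R prime_gt1R prime_neq0R : core.

Lemma padic_norm0 : norm 0 = 0.
Proof. by rewrite /padic_norm padic_abs0 rmorph0. Qed.

Lemma padic_normM x y : norm (x * y) = norm x * norm y.
Proof. by rewrite /padic_norm padic_absM rmorphM. Qed.

Lemma padic_normB x y : norm (x - y) = norm (y - x).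
Proof. by rewrite /padic_norm -opprB padic_absN. Qed.

Lemma padic_normD x y r : norm x <= r -> norm y <= r -> norm (x + y) <= r.
Proof.
move=> xr yr; have := padic_absD x y.
rewrite -(ler_rat R) maxr_rat => /le_trans; apply.
by rewrite ge_max xr.
Qed.

Lemma padic_normDlt x y r : norm x < r -> norm y < r -> norm (x + y) < r.
Proof.
move=> xr yr; have := padic_absD x y.
rewrite -(ler_rat R) maxr_rat => /le_lt_trans; apply.
by rewrite gt_max xr.
Qed.

Lemma ratr_exprz (k : int) : ratr (p%:R ^ k) = p%:R ^ k :> R.
Proof. by rewrite fmorphXz rmorph_nat. Qed.

Lemma padic_norm_value x : x != 0 -> exists k : int, norm x = p%:R ^ k.
Proof.
by move=> /padic_abs_value[k xk]; exists k; rewrite /padic_norm xk ratr_exprz.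
Qed.

Lemma Qp_prime_neq0 : p%:R != 0 :> Qp.
Proof.
apply/eqP => p0; have := padic_abs_p p_prime; rewrite p0 padic_abs0 => /eqP.
by rewrite eq_sym invr_eq0 pnatr_eq0 -leqn0 leqNgt prime_gt0.
Qed.
Hint Resolve Qp_prime_neq0 : core.

Lemma padic_norm_exprz (k : int) : norm (p%:R ^ k) = p%:R ^ (- k).
Proof.
have norm1 : norm 1 = 1.
  by rewrite /padic_norm (padic_abs_nat p_prime 1) qabs1 // rmorph1.
have normp : norm p%:R = p%:R^-1.
  by rewrite /padic_norm padic_abs_p fmorphV rmorph_nat.
have normX m : norm (p%:R ^+ m) = p%:R ^- m.
  elim: m => [|m IH]; first by rewrite expr0 invr1.
  by rewrite !exprS padic_normM IH normp invfM.
case: k => m; first by rewrite -!exprnP normX -exprnN.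
rewrite NegzE opprK -exprnN.
(* Negative exponents: multiplying by [p ^- m.+1], which is the norm of [p ^+ m.+1], reduces the
   claim to the norm of 1. *)
apply: (mulfI (x := p%:R ^- m.+1)); first by rewrite invr_eq0 expf_neq0.
rewrite -normX -padic_normM mulfV ?expf_neq0 // norm1 normX.
by rewrite -exprnP mulVf ?expf_neq0.
Qed.

(** The norm takes values in 0 and the integer powers of [p] only, so it skips the gap between
    [p ^ k] and [p ^ (k + 1)]. This turns open balls into closed balls of the next smaller
    radius. *)
Lemma padic_norm_lt x (k : int) : norm x < p%:R ^ (k + 1) -> norm x <= p%:R ^ k.
Proof.
have [->|/padic_norm_value[m ->]] := eqVneq x 0.
  by rewrite padic_norm0 => _; rewrite exprz_ge0 // ltW.
by rewrite ltr_eXz2l // ler_eXz2l // ltzD1.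
Qed.

Lemma padic_norm_natB (i j : nat) : (i < p)%N -> (j < p)%N -> i != j ->
  norm (i%:R - j%:R) = 1.
Proof.
wlog ij : i j / (i < j)%N => [H ip jp|].
  rewrite neq_ltn => /orP[ij|ji]; first by rewrite H// ltn_eqF.
  by rewrite padic_normB H// ltn_eqF.
move=> ip jp _; rewrite padic_normB -natrB; last exact: ltnW.
rewrite /padic_norm padic_abs_nat (_ : (j - i)%:R = (Posz (j - i))%:~R) //.
rewrite qabs_int_unit ?rmorph1 //=.
by apply/negP => /dvdn_leq; lia.
Qed.

(** Scaling by [p ^ (- n)] reduces this to the leading digit of an element of norm at most 1. *)
Lemma padic_norm_digit x (n : int) : norm x <= p%:R ^ (- n) ->
  exists i : 'I_p, norm (x - i%:R * p%:R ^ n) <= p%:R ^ (- (n + 1)).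
Proof.
move=> xn; pose y := x * p%:R ^ (- n).
have pn0 k : p%:R ^ k != 0 :> R by rewrite expfz_neq0.
have y1 : norm y <= 1.
  rewrite padic_normM padic_norm_exprz opprK -[leRHS](mulVf (pn0 n)).
  by rewrite ler_pM2r ?exprz_gt0 // invr_expz.
have [|i ip iy] := padic_abs_digit (x := y).
  by rewrite -(ler_rat R) rmorph1.
exists (Ordinal ip).
have -> : x - i%:R * p%:R ^ n = (y - i%:R) * p%:R ^ n.
  by rewrite mulrBl /y -mulrA -expfzDr // addNr expr0z mulr1.
rewrite padic_normM padic_norm_exprz opprD [- n + _]addrC expfzDr //.
rewrite ler_pM2r ?exprz_gt0 //; apply: padic_norm_lt.
by rewrite addNr expr0z /padic_norm -(rmorph1 (ratr : rat -> R)) ltr_rat.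
Qed.

Lemma padic_ball_center a r : 0 <= r -> padic_ball a r a.
Proof. by move=> r0; rewrite /padic_ball /= subrr padic_norm0. Qed.

Lemma padic_ball_sub a b r s : r <= s -> padic_ball a s b ->
  padic_ball b r `<=` padic_ball a s.
Proof.
move=> rs ab x; rewrite /padic_ball /= => xb.
by rewrite -(subrKA b) padic_normD // (le_trans xb).
Qed.

Lemma padic_ball_sym a b r : padic_ball a r b -> padic_ball b r a.
Proof. by rewrite /padic_ball /= padic_normB. Qed.

Lemma padic_ball_translate a r :
  padic_ball a r = [set a + x | x in padic_ball (0 : Qp) r].
Proof.
apply/seteqP; split => [x ax|_ [x + <-]].
  by exists (x - a); rewrite ?subrKC // /padic_ball /= subr0.
by rewrite /padic_ball /= subr0 addrAC subrr add0r.
Qed.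

(** For distinct digits, [(j - i) * p ^ n] has norm exactly [p ^ (- n)], whereas a common point
    would bound it by [p ^ (- (n + 1))]. *)
Lemma padic_ball_digit_inj (n : int) (i j : 'I_p) x :
  padic_ball (i%:R * p%:R ^ n : Qp) (p%:R ^ (- (n + 1)) : R) x ->
  padic_ball (j%:R * p%:R ^ n : Qp) (p%:R ^ (- (n + 1)) : R) x -> i = j.
Proof.
move=> xi xj; apply/eqP/negPn/negP => ij.
have : norm ((j%:R - i%:R) * p%:R ^ n) <= p%:R ^ (- (n + 1)).
  have -> : (j%:R - i%:R) * p%:R ^ n =
      (x - i%:R * p%:R ^ n) + (j%:R * p%:R ^ n - x).
    by rewrite mulrBl [RHS]addrC addrA subrK.
  by apply: padic_normD => //; rewrite padic_normB.
rewrite padic_normM padic_norm_natB //; last by rewrite eq_sym.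
by rewrite padic_norm_exprz mul1r ler_eXz2l //; lia.
Qed.

Lemma open_padic_ball a (k : int) : open (padic_ball a (p%:R ^ k : R)).
Proof.
(* The metric of the topology is [rat]-valued, so the radius must be given in [rat]; a power of [p]
   exists both there and in [R]. *)
apply/Qp_openP => x ax; exists (p%:R ^ k).
  by rewrite exprz_gt0 // ltr0n prime_gt0.
move=> y; rewrite -(ltr_rat R) ratr_exprz => xy.
apply: padic_ball_sub ax _ _ => //; rewrite /padic_ball /= padic_normB.
exact: ltW.
Qed.

Lemma measurable_padic_ball a (k : int) :
  measurable (padic_ball a (p%:R ^ k : R) : set (Qp_borel p_prime)).
Proof. by apply: sub_sigma_algebra; exact: open_padic_ball. Qed.

End PadicNorm.

(** * Haar measure of balls *)

Section Haar.
Variables (R : realType) (p : nat) (p_prime : prime p).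
Notation Qp := (Qp p_prime).
Variable mu : {measure set (Qp_borel p_prime) -> \bar R}.
Hypothesis mu_haar : is_haar mu.

Let ball (a : Qp) (n : int) : set (Qp_borel p_prime) :=
  padic_ball a (p%:R ^ (- n) : R).

Let mu_translate a n : mu (ball a n) = mu (ball 0 n).
Proof.
rewrite /ball padic_ball_translate; apply: (proj1 mu_haar).
exact: measurable_padic_ball.
Qed.

Lemma haar_ball_digits n : mu (ball 0 n) = (p%:R%:E * mu (ball 0%R (n + 1)%R))%E.
Proof.
have -> : ball 0 n = \big[setU/set0]_(i < p) ball (i%:R * p%:R ^ n) (n + 1).
  rewrite -bigcup_seq; apply/seteqP; split => x.
    rewrite /ball /padic_ball /= subr0 => /padic_norm_digit[i xi].
    by exists i; rewrite /= ?mem_index_enum.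
  move=> [i /= _].
  suff : ball (i%:R * p%:R ^ n) (n + 1) `<=` ball 0 n by apply.
  apply: padic_ball_sub; first by rewrite ler_eXz2l ?prime_gt1R //; lia.
  rewrite /padic_ball /= subr0 padic_normM padic_norm_exprz ler_piMl//.
    by rewrite exprz_ge0 // ler0n.
  have [->|i0] := eqVneq (i : nat) 0; first by rewrite padic_norm0 ler01.
  by have := padic_norm_natB R p_prime (ltn_ord i) (prime_gt0 p_prime) i0;
    rewrite subr0 => ->.
rewrite measure_bigsetU_ord.
- rewrite (eq_bigr (fun=> mu (ball 0 (n + 1)))); last by move=> i _; exact: mu_translate.
  by rewrite sumr_const card_ord mule_natl.
- by move=> i; exact: measurable_padic_ball.
- apply/trivIsetP => i j _ _ ij; rewrite -subset0 => x [xi xj].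
  by move: ij; rewrite (padic_ball_digit_inj xi xj) eqxx.
Qed.

(** Starting from mass 1 for the unit ball, induction runs both ways: each smaller radius divides
    the mass by [p], each larger one multiplies it by [p]. *)
Lemma haar_ball a n : mu (ball a n) = (p%:R ^ (- n))%:E.
Proof.
rewrite mu_translate; have p0 := prime_neq0R R p_prime.
have down k : mu (ball 0 (k + 1)) = (p%:R^-1%:E * mu (ball 0%R k))%E.
  by rewrite (haar_ball_digits k) muleA -EFinM mulVf // mul1e.
case: n => m; elim: m => [|m IH].
- by rewrite oppr0 expr0z -(proj2 mu_haar) /ball oppr0 expr0z.
- by rewrite -addn1 PoszD down IH opprD expfzDr // EFinM muleC.
(* [Negz m] is [-(m + 1)], so this base case is the ball of radius [p], one level above the unit
   ball. *)
- rewrite haar_ball_digits NegzE addNr opprK expr1z.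
  by rewrite -[0]oppr0 -/(ball 0 _) /ball oppr0 expr0z (proj2 mu_haar) mule1.
- rewrite haar_ball_digits (_ : Negz m.+1 + 1 = Negz m); last by lia.
  by rewrite IH !NegzE !opprK -EFinM -exprSz.
Qed.

End Haar.

(** * The equivalence relation behind the convex components *)

Section ConvexEquiv.
Variables (R : realType) (p : nat) (p_prime : prime p).
Notation Qp := (Qp p_prime).
Variable Omega : set Qp.
Notation equiv := (convex_equiv R Omega).

Lemma convex_equiv_refl x : open Omega -> Omega x -> equiv x x.
Proof.
move=> /Qp_openP/[apply] -[e e0 xe].
(* Openness speaks of strict inequalities and [convex_equiv] of closed balls; halving [e] bridges
   the two. *)
have e2 : 0 < ratr (e / 2) :> R by rewrite ltr0q divr_gt0.
exists x, (ratr (e / 2)); split; [by []| |exact/padic_ball_center/ltW..].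
move=> y; rewrite /padic_ball /= padic_normB ler_rat => xy; apply: xe.
by rewrite (le_lt_trans xy) // ltr_pdivrMr // ltr_pMr // ltr1n.
Qed.

Lemma convex_equiv_sym x y : equiv x y -> equiv y x.
Proof. by move=> [a [r [r0 ra ax ay]]]; exists a, r. Qed.

Lemma convex_equiv_trans y x z : equiv x y -> equiv y z -> equiv x z.
Proof.
(* Two balls with a common point are nested. *)
have nested a b r s : r <= s -> padic_ball a r y -> padic_ball b s y ->
    padic_ball a r `<=` padic_ball b s.
  move=> rs ay bY; apply: padic_ball_sub => //.
  exact: padic_ball_sub bY _ (padic_ball_sym ay).
move=> [a [r [r0 aO ax ay]]] [b [s [s0 bO bY bz]]].
have [rs|/ltW sr] := leP r s.
- by exists b, s; split => //; exact: nested rs ay bY _ ax.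
- by exists a, r; split => //; exact: nested sr bY ay _ bz.
Qed.

End ConvexEquiv.

(** * Disjoint decomposition into components and the shape of the thin neighborhood *)

Section Components.
Variables (R : realType) (p : nat) (p_prime : prime p).
Notation Qp := (Qp p_prime).
Variables (Omega : set Qp) (J : set nat) (a : nat -> Qp) (n : nat -> int).
Hypothesis Omega_open : open Omega.
Hypothesis enumJ : component_enumeration R Omega J a n.

Let len j : R := p%:R ^ (- n j).
Let B j : set Qp := padic_ball (a j) (len j).

Let len_gt0 j : 0 < len j.
Proof. by rewrite exprz_gt0 ?prime_gt0R. Qed.

Lemma component_subset j : J j -> B j `<=` Omega.
Proof.
move=> Jj; have [/(_ j Jj)[x _ Bx] _ _] := enumeration_bij enumJ.
by move: Bx => /= Bx y; rewrite /B /len -Bx => -[].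
Qed.

Lemma component_cover x : Omega x -> exists2 j, J j & B j x.
Proof.
move=> Ox; have [_ _ h] := enumeration_bij enumJ.
have [|j Jj Bj] := h [set y | Omega y /\ convex_equiv R Omega x y]; first by exists x.
by exists j => //; rewrite /B Bj; split => //; exact: convex_equiv_refl.
Qed.

(** Both balls are equivalence classes; a common point makes them equal as sets, and the enumeration
    is injective. *)
Lemma component_inj i j x : J i -> J j -> B i x -> B j x -> i = j.
Proof.
move=> Ji Jj ix jx; have [f inj _] := enumeration_bij enumJ.
apply: inj; rewrite ?inE //.
move: (f i Ji) (f j Jj) ix jx => [y _ /= yi] [z _ /= zj].
rewrite /B /len -yi -zj => -[_ yx] [_ zx].
apply/seteqP; split => w [Ow]; split => //.
  exact: convex_equiv_trans zx (convex_equiv_trans (convex_equiv_sym yx) _).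
exact: convex_equiv_trans yx (convex_equiv_trans (convex_equiv_sym zx) _).
Qed.

Lemma component_trivIset : trivIset J B.
Proof. by move=> i j Ji Jj [x [ix jx]]; exact: component_inj ix jx. Qed.

Lemma component_bigcup : Omega = \bigcup_(j in J) B j.
Proof.
apply/seteqP; split => [x /component_cover[j Jj jx]|x [j /component_subset]].
  by exists j.
exact.
Qed.

(* For x in B_j off the sphere S_j, the distance to S_j is p^-n_j by the
   isosceles property, and every other sphere lies outside B_j, hence farther. *)
Lemma thin_inner_nbhdE eps :
  thin_inner_nbhd Omega J a n eps =
  \bigcup_(j in [set j | J j /\ len j < eps])
     padic_ball (a j) (p%:R ^ (- (n j + 1)) : R).
Proof.
have lenS j : p%:R ^ (- (n j + 1)) < len j.
  by rewrite ltr_eXz2l ?prime_gt1R //; lia.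
apply/seteqP; split => x.
- move=> [[Ox /ereal_inf_lt[_ [y [i Ji iy] <-]]]]; rewrite lte_fin => xy nx.
  have [j Jj jx] := component_cover Ox.
  have xj : padic_norm R (x - a j) < len j.
    rewrite lt_neqAle jx andbT; apply/eqP => xj; by apply: nx; exists j.
  exists j; last first.
    by apply: padic_norm_lt; rewrite (_ : - (n j + 1) + 1 = - n j) //; lia.
  (* If [x] were closer than [len j] to the boundary point [y], then [y] would lie inside [B j] off
     its sphere; but disjointness forces the sphere of [y] to be the one of [B j]. *)
  split => //; apply: le_lt_trans xy; rewrite leNgt; apply/negP => xy.
  have jy : padic_norm R (y - a j) < len j.
    by rewrite -(subrKA x) padic_normDlt // padic_normB.
  have iB : B i y by rewrite /B /padic_ball /= iy.
  have ij := component_inj Ji Jj iB (ltW jy).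
  by move: jy; rewrite -ij iy ltxx.
- move=> [j [Jj jeps] jx].
  have xj : padic_norm R (x - a j) < len j := le_lt_trans jx (lenS j).
  split; last first.
    move=> [i Ji ix].
    have iB : B i x by rewrite /B /padic_ball /= ix.
    have ij := component_inj Ji Jj iB (ltW xj).
    by move: xj; rewrite -ij ix ltxx.
  split; first exact: component_subset (ltW xj).
  (* An explicit point of the sphere of [B j], since [p ^ n j] has norm [len j]; it bounds the
     distance from [x] to the boundary. *)
  pose y := a j + p%:R ^ n j.
  have yj : padic_norm R (y - a j) = len j.
    by rewrite /y addrAC subrr add0r padic_norm_exprz.
  apply: (@le_lt_trans _ _ (padic_norm R (x - y))%:E).
    by apply: ereal_inf_lbound; exists y => //; exists j.
  rewrite lte_fin; apply: le_lt_trans jeps.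
  rewrite -(subrKA (a j)) padic_normD //; first exact: ltW.
  by rewrite padic_normB yj.
Qed.

End Components.

(** * Volumes as series of lengths *)

Section HaarComponents.
Variables (R : realType) (p : nat) (p_prime : prime p).
Notation Qp := (Qp p_prime).
Variable mu : {measure set (Qp_borel p_prime) -> \bar R}.
Hypothesis mu_haar : is_haar mu.
Variables (Omega : set Qp) (J : set nat) (a : nat -> Qp) (n : nat -> int).
Hypothesis Omega_string : fractal_string R Omega.
Hypothesis enumJ : component_enumeration R Omega J a n.

Let len j : R := p%:R ^ (- n j).

Lemma haar_fractal_string :
  mu Omega = (\sum_(j <oo | j \in J) (len j)%:E)%E.
Proof.
rewrite (component_bigcup (proj1 Omega_string) enumJ) measure_bigcup.
- by apply: eq_eseriesr => j _; exact: haar_ball.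
- by move=> j _; exact: measurable_padic_ball.
- exact: component_trivIset enumJ.
Qed.

(** Boundedness encloses the string in a ball of finite mass; this is the source of the convergence
    of the zeta series at 1. *)
Lemma haar_fractal_string_fin : (mu Omega < +oo)%E.
Proof.
have [Oop [r Or]] := Omega_string.
(* With [N] the natural number bounding [|r|], one has [r <= N <= p ^ N]. The double negation gives
   the radius the form expected by [haar_ball]. *)
pose B : set (Qp_borel p_prime) :=
  padic_ball (0 : Qp) (p%:R ^ (- - (Num.bound `|r|)%:Z) : R).
have OB : Omega `<=` B.
  move=> x Ox; rewrite /B opprK.
  have /le_trans := Or x Ox; apply; apply: le_trans (ler_norm r) _.
  apply: le_trans (ltW (archi_boundP (normr_ge0 r))) _.
  by rewrite -exprnP -natrX ler_nat ltnW // ltn_expl // prime_gt1.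
have : (mu Omega <= mu B)%E.
  apply: le_measure; rewrite ?inE //.
    by apply: sub_sigma_algebra.
  exact: measurable_padic_ball.
by rewrite /B haar_ball // => /le_lt_trans; apply; rewrite ltry.
Qed.

(** The factor [p^-1] is the ratio of the mass of a component without its sphere to the mass of the
    whole component. *)
Lemma thin_inner_volumeE eps :
  thin_inner_volume mu Omega J a n eps =
  ((p%:R^-1)%:E * \sum_(j <oo | (j \in J) && (len j < eps)%R) (len j)%:E)%E.
Proof.
have Oop := proj1 Omega_string.
rewrite /thin_inner_volume (thin_inner_nbhdE Oop enumJ) measure_bigcup.
- rewrite -nneseriesZl; last by move=> j _; rewrite lee_fin exprz_ge0 ?ler0n.
  rewrite (@eq_eseriesl R _ (fun j => (j \in J) && (len j < eps)%R)); last first.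
    move=> j; apply/idP/idP; rewrite inE.
      by move=> [Jj ->]; rewrite mem_set.
    by move=> /andP[/set_mem].
  apply: eq_eseriesr => j _; rewrite [LHS]haar_ball //.
  by rewrite opprD expfzDr ?prime_neq0R // mulrC EFinM.
- by move=> j _; exact: measurable_padic_ball.
- move=> i j [Ji _] [Jj _] [x [ix jx]].
  have sub k : padic_ball (a k) (p%:R ^ (- (n k + 1)) : R) x ->
      padic_ball (a k) (len k) x.
    by move=> /le_trans; apply; rewrite ler_eXz2l ?prime_gt1R //; lia.
  exact: component_inj enumJ _ _ _ Ji Jj (sub _ ix) (sub _ jx).
Qed.

End HaarComponents.

(** * Transfer of real limits to the complex numbers *)

Section ComplexSeries.
Variable R : realType.

Lemma cvg_real_complex (u : R^nat) (l : R) :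
  u m @[m --> \oo] --> l ->
  ((u m)%:C%C : R[i]^o) @[m --> \oo] --> (l%:C%C : R[i]^o).
Proof.
move=> /cvgrPdist_lt ul; apply/cvgrPdist_lt => e e0.
(* In the partial order of [R[i]], [0 < e] forces [e] to be real. *)
have eR : (complex.Re e)%:C%C = e by apply/RRe_real/gtr0_real.
have : 0 < complex.Re e by move: e0; rewrite ltcE => /andP[].
move=> /ul; apply: filterS => m um.
have -> : l%:C%C - (u m)%:C%C = (l - u m)%:C%C :> R[i] by rewrite -rmorphB.
by rewrite normc_def /= expr0n addr0 sqrtr_sqr -eR ltcR.
Qed.

Lemma cpow1 (t : R) : 0 < t -> cpow t 1 = t%:C%C.
Proof.
move=> t0; rewrite /cpow /= mul1r mul0r cos0 sin0 lnK //.
by rewrite complexr0 mulr1.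
Qed.

End ComplexSeries.

(** * The threshold index and the tails of a nonincreasing summable sequence *)

Section LargeTerms.
Variables (R : realType) (p : nat) (J : set nat) (n : nat -> int).
Let len j : R := p%:R ^ (- n j).
Hypothesis p_gt0 : (0 < p)%N.
Hypothesis J_gt0 : forall j, J j -> (0 < j)%N.
Hypothesis J_initial : forall i j, J j -> (0 < i <= j)%N -> J i.
Hypothesis len_mono : forall i j, J i -> J j -> (i <= j)%N -> len j <= len i.
Hypothesis len_fin : (\sum_(j <oo | j \in J) (len j)%:E < +oo)%E.

Let len_gt0 j : 0 < len j.
Proof. by rewrite exprz_gt0 // ltr0n. Qed.

Lemma tail_sum_fin_num N : (\sum_(N <= j <oo | j \in J) (len j)%:E)%E \is a fin_num.
Proof.
rewrite ge0_fin_numE; last first.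
  by apply: nneseries_ge0 => j _ _; rewrite lee_fin ltW.
apply: le_lt_trans len_fin; rewrite eseries_cond.
rewrite eseries_mkcondr; apply: lee_nneseries => j.
  by move=> _ _; case: ifP => // _; rewrite lee_fin ltW.
by move=> _; case: ifP => // _; rewrite lee_fin ltW.
Qed.

(** If [len j >= eps], monotonicity makes the first [j] terms all at least [eps], so [j * eps] is at
    most the total sum. *)
Lemma large_terms_bounded (eps : R) : 0 < eps ->
  exists M, forall j, J j -> eps <= len j -> (j <= M)%N.
Proof.
move=> eps0; set S := (\sum_(j <oo | j \in J) (len j)%:E)%E.
have S_fin : S \is a fin_num by exact: tail_sum_fin_num.
exists (Num.bound (fine S / eps)) => j Jj ej.
have S0 : 0 <= fine S.
  by apply/fine_ge0/nneseries_ge0 => i _ _; rewrite lee_fin ltW.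
have : j%:R * eps <= fine S.
  rewrite -lee_fin fineK //.
  apply: (@le_trans _ _ (\sum_(0 <= i < j.+1 | i \in J) (len i)%:E)%E); last first.
    by apply: nneseries_lim_ge => i _ _; rewrite lee_fin ltW.
  rewrite sumEFin lee_fin big_mkcond big_nat_recl //=.
  (* Index 0 lies outside [J], which leaves exactly the [j] terms with indices 1 to [j]. *)
  rewrite [X in X + _](_ : _ = 0) ?add0r; last first.
    by case: ifP => // /set_mem/J_gt0.
  rewrite mulr_natl -{1}[j]subn0 -sumr_const_nat !big_nat.
  apply: ler_sum => i /andP[_ ij].
  have Ji : J i.+1 by apply: J_initial Jj _; rewrite ij.
  by rewrite mem_set //; apply: le_trans ej _; exact: len_mono.
rewrite -ler_pdivlMr // => h.
by rewrite -(ler_nat R) (le_trans h) // ltW // archi_boundP // divr_ge0 // ltW.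
Qed.

Lemma last_large_index_exists (eps : R) : 0 < eps ->
  exists k, last_large_index p J n eps k.
Proof.
move=> /large_terms_bounded[M bound].
have [[j [Jj ej]]|none] := pselect (exists j, J j /\ eps <= len j); last first.
  exists 0; left; split => // j Jj; rewrite ltNge; apply/negP => ej.
  by apply: none; exists j.
pose P j := (j \in J) && (eps <= len j).
have PM i : P i -> (i <= M)%N by move=> /andP[/set_mem]; exact: bound.
have exP : exists j, P j by exists j; rewrite /P mem_set.
have [k /andP[/set_mem Jk ek] kmax] := ex_maxnP exP PM.
by exists k; right; split => // i Ji ei; apply: kmax; rewrite /P mem_set.
Qed.

(** Monotonicity converts the threshold on lengths into one on indices. When [k = 0], both tests
    hold on all of [J], as indices start at 1. *)
Lemma small_indexE (eps : R) k j : last_large_index p J n eps k ->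
  (j \in J) && (len j < eps) = (j \in J) && (k < j)%N.
Proof.
move=> kP; case: (boolP (j \in J)) => //= /set_mem Jj.
case: kP => [[-> /(_ j Jj) ->]|[Jk ek kmax]]; first by rewrite J_gt0.
apply/idP/idP => [|kj].
  apply: contraTT; rewrite -leNgt -leqNgt => jk.
  exact: le_trans ek (len_mono Jj Jk jk).
by rewrite ltNge; apply/negP => /(kmax _ Jj); rewrite leqNgt kj.
Qed.

(** Ensures that the finite sum over [1 <= j <= k] in the theorem ranges over existing indices
    only. *)
Lemma index_le_last (eps : R) k j : last_large_index p J n eps k ->
  (0 < j < k.+1)%N -> J j.
Proof.
move=> [[-> _]|[Jk _ _]]; first by case: j.
by rewrite ltnS; exact: J_initial.
Qed.

(** At [s = 1] each [cpow] term is the real length itself, so convergence comes from the finite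
    nonnegative series. *)
Lemma cvg_geometric_zeta_partial1 :
  geometric_zeta_partial p J n (1 : R[i]) @ \oo -->
  ((fine (\sum_(1 <= j <oo | j \in J) (len j)%:E)%E)%:C%C : R[i]^o).
Proof.
have -> : geometric_zeta_partial p J n (1 : R[i]) =
    fun m => (\sum_(1 <= j < m.+1 | j \in J) len j)%:C%C.
  apply/funext => m; rewrite /geometric_zeta_partial (rmorph_sum (real_complex R)).
  by apply: eq_bigr => j _; rewrite cpow1 // exprz_gt0 // ltr0n.
apply: (@cvg_real_complex _ (fun m => \sum_(1 <= j < m.+1 | j \in J) len j)).
rewrite (cvg_shiftS (fun m => \sum_(1 <= j < m | j \in J) len j)).
set S := (\sum_(1 <= j <oo | j \in J) (len j)%:E)%E.
have : (\sum_(1 <= j < m | j \in J) (len j)%:E)%E @[m --> \oo] --> S.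
  by apply: is_cvg_nneseries => j _ _; rewrite lee_fin ltW.
rewrite -[S]fineK; last by apply: tail_sum_fin_num.
by move=> /fine_cvg; under eq_fun do rewrite /= sumEFin /=.
Qed.

Lemma small_terms_sum (eps : R) k : last_large_index p J n eps k ->
  (\sum_(j <oo | (j \in J) && (len j < eps)%R) (len j)%:E =
   \sum_(k.+1 <= j <oo | j \in J) (len j)%:E)%E.
Proof.
move=> kP; rewrite [RHS]eseries_cond; apply: eq_eseriesl => j.
exact: small_indexE.
Qed.

(** Splits the series after index [k]; all pieces are finite, so the head can be subtracted. *)
Lemma tail_sum_fine (eps : R) k : last_large_index p J n eps k ->
  (fine (\sum_(k.+1 <= j <oo | j \in J) (len j)%:E)%E)%:C%C =
  geometric_zeta p J n (1 : R[i]) - \sum_(1 <= j < k.+1) (len j)%:C%C.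
Proof.
move=> kP; rewrite /geometric_zeta.
rewrite (cvg_lim _ cvg_geometric_zeta_partial1); last exact: norm_hausdorff.
rewrite (nneseries_split_cond 1 k); last by move=> j _; rewrite lee_fin ltW.
rewrite add1n sumEFin fineD //; last exact: tail_sum_fin_num.
rewrite -(rmorph_sum (real_complex R)) -rmorphB /=; congr (_%:C%C).
rewrite [X in _ = X + _ - _](_ : _ = \sum_(1 <= j < k.+1) len j).
  by rewrite addrAC subrr add0r.
rewrite big_mkcond !big_nat; apply: eq_bigr => j jk.
by rewrite mem_set //; exact: index_le_last kP jk.
Qed.

End LargeTerms.

Theorem theorem3p16 (R : realType) (p : nat) (p_prime : prime p)
  (mu : {measure set (Qp_borel p_prime) -> \bar R})
  (Omega : set (Qp p_prime)) (J : set nat) (a : nat -> Qp p_prime)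
  (n : nat -> int) (eps : R) :
  is_haar mu ->
  fractal_string R Omega ->
  component_enumeration R Omega J a n ->
  0 < eps ->
  let V := thin_inner_volume mu Omega J a n eps in
  let len (j : nat) : R := p%:R ^ (- n j) in
  exists k : nat,
    [/\ last_large_index p J n eps k,
        V = ((p%:R^-1)%:E * \sum_(k.+1 <= j <oo | j \in J) (len j)%:E)%E,
        V = ((p%:R^-1)%:E *
             \sum_(1 <= j <oo | (j \in J) && (len j < eps)%R) (len j)%:E)%E &
        [/\ cvgn (geometric_zeta_partial p J n (1 : R[i])),
            V \is a fin_num &
            (fine V)%:C%C =
              p%:R^-1 * (geometric_zeta p J n 1 -
                         \sum_(1 <= j < k.+1) (len j)%:C%C)]].
Proof.
move=> mu_haar Omega_string enumJ eps0 V len.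
have p_gt0 := prime_gt0 p_prime.
have J_gt0 := enumeration_index enumJ.
have J_initial := enumeration_initial enumJ.
have len_mono := enumeration_nonincreasing enumJ.
have len_fin := haar_fractal_string_fin mu_haar Omega_string.
rewrite (haar_fractal_string mu_haar Omega_string enumJ) in len_fin.
have [k kP] :=
  last_large_index_exists p_gt0 J_gt0 J_initial len_mono len_fin eps0.
have VE := thin_inner_volumeE mu_haar Omega_string enumJ eps.
have Vk : V = ((p%:R^-1)%:E * \sum_(k.+1 <= j <oo | j \in J) (len j)%:E)%E.
  by rewrite /V VE (small_terms_sum J_gt0 len_mono kP).
have Tfin : (\sum_(k.+1 <= j <oo | j \in J) (len j)%:E)%E \is a fin_num.
  exact: tail_sum_fin_num.
exists k; split => //.
(* The series in [VE] starts at 0 and the stated one at 1; they agree because 0 is not in [J]. *)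
- rewrite /V VE [in RHS]eseries_cond; congr (_ * _)%E; apply: eq_eseriesl => j.
  by case: (boolP (j \in J)) => //= /set_mem/J_gt0 ->; rewrite andbT.
- split.
  + by apply/cvg_ex; eexists; exact: cvg_geometric_zeta_partial1.
  + by rewrite Vk fin_numM.
  rewrite Vk fineM //= -(tail_sum_fine p_gt0 J_initial len_fin kP).
  have -> : p%:R^-1 = (p%:R^-1)%:C%C :> R[i].
    by rewrite (fmorphV (real_complex R)) (rmorph_nat (real_complex R)).
  by rewrite -(rmorphM (real_complex R)).
Qed.
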